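(* For every $d\in\mathbb{N}=\{1,2,\dots\}$, there exists a finite abelian cover of the Chamanara surface $X$ with exactly $d$ ends.
   Context: Chamanara surface: take the open unit square $(0,1)^2$ and, for each $n\ge 1$, add open boundary segments and glue them by translations: the left segment $\{0\}\times(1-2^{1-n},1-2^{-n})$ is glued to the right segment $\{1\}\times(2^{-n},2^{1-n})$; the bottom segment $(1-2^{1-n},1-2^{-n})\times\{0\}$ is glued to the top segment $(2^{-n},2^{1-n})\times\{1\}$. The result $X$ (endpoints of segments and corners not included) is a translation surface. A finite abelian cover is a connected normal covering of $X$ with finite abelian deck group; its ends are the topological ends of the covering surface. *)

(* Defs.v *)
From HB Require Import structures.
From Stdlib Require Import Relations.
From mathcomp Require Import all_boot all_order all_algebra generic_quotient.
From mathcomp Require Import all_classical all_reals topology normedtype.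
Set Implicit Arguments.
Unset Strict Implicit.
Unset Printing Implicit Defensive.
Import Order.TTheory GRing.Theory Num.Theory.
Import numFieldNormedType.Exports.
Local Open Scope classical_set_scope.
Local Open Scope ring_scope.

Section ChamanaraSurface.
Variable R : realType.

Definition left_edge (n : nat) : set (R * R) :=
  [set 0] `*` `]1 - 2 ^- n.-1, 1 - 2 ^- n[.
Definition right_edge (n : nat) : set (R * R) :=
  [set 1] `*` `]2 ^- n, 2 ^- n.-1[.
Definition bottom_edge (n : nat) : set (R * R) :=
  `]1 - 2 ^- n.-1, 1 - 2 ^- n[ `*` [set 0].
Definition top_edge (n : nat) : set (R * R) :=
  `]2 ^- n, 2 ^- n.-1[ `*` [set 1].

Definition square_with_edges : set (R * R) :=
  `]0, 1[ `*` `]0, 1[ `|`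
  \bigcup_(n in [set n | (0 < n)%N])
    (left_edge n `|` right_edge n `|` (bottom_edge n `|` top_edge n)).

(* [2 ^- n - (1 - 2 ^- n.-1)] is the difference between the lower endpoint of
   the right (top) segment and that of the left (bottom) segment. *)
Definition glued (z w : square_with_edges) : Prop :=
  exists2 n : nat, (0 < n)%N &
    [/\ left_edge n (val z), right_edge n (val w) &
        val w = val z + (1, 2 ^- n - (1 - 2 ^- n.-1))] \/
    [/\ bottom_edge n (val z), top_edge n (val w) &
        val w = val z + (2 ^- n - (1 - 2 ^- n.-1), 1)].

Definition same_point (z w : square_with_edges) : bool :=
  `[< clos_refl_sym_trans _ glued z w >].

Lemma same_point_refl : reflexive same_point.
Proof. by move=> z; apply/asboolP; exact: rst_refl. Qed.

Lemma same_point_sym : symmetric same_point.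
Proof. by move=> z w; apply/asboolP/asboolP => ?; exact: rst_sym. Qed.

Lemma same_point_trans : transitive same_point.
Proof.
move=> w z t /asboolP zw /asboolP wt; apply/asboolP.
exact: rst_trans zw wt.
Qed.

Canonical same_point_equiv :=
  EquivRel same_point same_point_refl same_point_sym same_point_trans.

Definition chamanara : topologicalType :=
  quotient_topology {eq_quot same_point_equiv}%qT.

End ChamanaraSurface.

Definition homeomorphism_between (S T : topologicalType) (A : set S)
    (B : set T) (f : S -> T) : Prop :=
  {within A, continuous f} /\
  exists2 g : T -> S, {within B, continuous g} &
    [/\ set_fun A B f, set_fun B A g, {in A, cancel f g} & {in B, cancel g f}].

Section Coverings.
Variables (Y X : topologicalType) (p : Y -> X).

Definition evenly_covered (U : set X) : Prop :=
  exists F : set (set Y),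
    [/\ p @^-1` U = \bigcup_(V in F) V, trivIset F id &
        forall V, F V -> open V /\ homeomorphism_between V U p].

Definition covering_map : Prop :=
  [/\ continuous p, set_surj [set: Y] [set: X] p &
      forall x : X, exists2 U : set X, open_nbhs x U & evenly_covered U].

Definition deck_group : set (Y -> Y) :=
  [set f | homeomorphism_between [set: Y] [set: Y] f /\ p \o f = p].

Definition normal_covering : Prop :=
  covering_map /\
  forall y y' : Y, p y = p y' -> exists2 f, deck_group f & f y = y'.

Definition finite_abelian_cover : Prop :=
  [/\ connected [set: Y], normal_covering, finite_set deck_group &
      {in deck_group &, forall f g, f \o g = g \o f}].

End Coverings.

(* The inverse limit, over the compact subsets [K] of [Y] ordered by inclusion,
   of the sets of connected components of [~` K].  A compatible family of
   components is encoded as a total function on subsets, normalised to [set0]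
   at non-compact arguments, so that distinct functions are distinct ends. *)
Definition ends (Y : topologicalType) : set (set Y -> set Y) :=
  [set e | [/\ forall K, compact K ->
                 (connected_component (~` K) @` (~` K)) (e K),
               forall K L, compact K -> compact L -> K `<=` L ->
                 e L `<=` e K &
               forall K, ~ compact K -> e K = set0]].
Arguments ends : clear implicits.

(* Main.v *)
(* The cover has deck group Z/d and monodromy 1 along the first horizontal and
   the first vertical gluing, 0 along all the others.  A path that winds around
   the missing points crosses these two gluings with cancelling signs, so the
   monodromy is trivial near infinity.  The points of the square at distance
   less than r from a missing point have a connected image in X, which hence
   has d disjoint lifts; letting r tend to 0, these lifts shrink to exactly d
   ends. *)
Require Import Defs.
From HB Require Import structures.
From Stdlib Require Import Relations.
From mathcomp Require Import all_boot all_order all_algebra generic_quotient.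
From mathcomp Require Import all_classical all_reals topology normedtype.
From mathcomp Require Import lra.
Set Implicit Arguments.
Unset Strict Implicit.
Unset Printing Implicit Defensive.
Import Order.TTheory GRing.Theory Num.Theory.
Import numFieldNormedType.Exports.

Local Open Scope classical_set_scope.

(** The missing points accumulate at the corners (0, 1) and (1, 0), and every gluing identifies
    points near one of them with points near another, so a neighbourhood of infinity has to treat
    all of them at once; a single radius r does this because the gluings are translations. Over such
    a neighbourhood the monodromy is shown to be trivial by an explicit coboundary rather than by
    examining loops: the sheets are renumbered by -a near (0, 0), by a near (1, 1), and not at all
    near the other missing points. The one correction -a at (0, 0) has to absorb the cocycle on the
    first left edge and on the first bottom edge together, which is why both gluings carry the same
    value. As a set the cover is the product of X and Z/d, and the twist sits only in its topology;
    deck transformations are then plain shifts of the second coordinate. *)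

(** * Uniqueness of lifts through a covering map *)

Lemma covering_lift_unique (Z Y X : topologicalType) (p : Y -> X)
    (f g : Z -> Y) (z0 : Z) :
  covering_map p -> connected [set: Z] -> continuous f -> continuous g ->
  p \o f = p \o g -> f z0 = g z0 -> f = g.
Proof.
move=> [_ _ pcov] Zconn fcont gcont pfg fg0.
(* Agreement of [f] and [g] is locally constant, hence both open and closed: near [z] each map stays
   in one slice, and two slices are either equal, with [p] injective on them, or disjoint. *)
have local z : exists2 O : set Z, open_nbhs z O &
    forall w, O w -> (f w = g w) <-> (f z = g z).
  have [U [_ Uz] [F [pU Fdisj FV]]] := pcov (p (f z)).
  have pgz : p (g z) = p (f z) by rewrite -[LHS]/((p \o g) z) -pfg.
  have [V FVf Vf] : (\bigcup_(V in F) V) (f z) by rewrite -pU.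
  have [V' FVg Vg] : (\bigcup_(V in F) V) (g z) by rewrite -pU /preimage/= pgz.
  have [Vo _] := FV _ FVf; have [Vo' _] := FV _ FVg.
  exists (f @^-1` V `&` g @^-1` V').
    split; last by [].
    by apply: openI; [move/continuousP: fcont|move/continuousP: gcont]; apply.
  move=> w [Vfw Vgw]; have [VV'|VV'] := pselect (V = V'); last first.
    split=> fg; exfalso; apply: VV'.
      by apply: (Fdisj V V' FVf FVg); exists (f w); split; rewrite //= fg.
    by apply: (Fdisj V V' FVf FVg); exists (f z); split; rewrite //= fg.
  subst V'; have [_ [_ [s _ [_ _ sK _]]]] := FV _ FVf.
  have inj a b : V a -> V b -> p a = p b -> a = b.
    by move=> Va Vb ab; rewrite -(sK a) ?inE// ab sK ?inE.
  have pw : p (f w) = p (g w) by rewrite -[LHS]/((p \o f) w) pfg.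
  by split=> _; apply: inj.
have DT : [set z | f z = g z] = [set: Z].
  apply: Zconn; first by exists z0.
    exists [set z | f z = g z]; last by rewrite setTI.
    rewrite openE => z /= fgz; have [O Oz Ofg] := local z.
    by rewrite /interior nbhsE; exists O => // w /Ofg[_]; apply.
  exists [set z | f z = g z]; last by rewrite setTI.
  rewrite -openC openE => z /= fgz; have [O Oz Ofg] := local z.
  by rewrite /interior nbhsE; exists O => // w /Ofg[fgw _] /fgw.
by apply/funext => z; have : [set: Z] z by []; rewrite -DT.
Qed.

(** * Ends of a space exhausted by compact sets with labelled complementary components *)

Section EndsOfExhaustion.
Variables (Y : topologicalType) (I : Type) (E : nat -> I -> set Y).
Hypothesis E_open : forall n i, open (E n i).
Hypothesis E_connected : forall n i, connected (E n i).
Hypothesis E_neq0 : forall n i, E n i !=set0.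
Hypothesis E_disjoint : forall n i j, E n i `&` E n j !=set0 -> i = j.
Hypothesis E_decr : forall m n i, (m <= n)%N -> E n i `<=` E m i.
Hypothesis E_cocompact : forall n, compact (~` \bigcup_i E n i).
Hypothesis E_escape : forall K, compact K ->
  exists n, \bigcup_i E n i `<=` ~` K.

(** The other sets [E n j] form an open set too, so [E n i] is both open and closed in the
    component. *)
Lemma component_bigcup_disjoint_open n i x : E n i x ->
  connected_component (\bigcup_i E n i) x = E n i.
Proof.
move=> Ex; set C := connected_component _ _; have Cx : C x.
  by apply: connected_component_refl; exists i.
apply/seteqP; split; last first.
  by apply: connected_component_max => // y Ey; exists i.
suff <- : C `&` E n i = C by move=> y [].
apply: (@component_connected _ (\bigcup_i E n i) x).
- by exists x.
- by exists (E n i).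
- exists (~` \bigcup_(j in [set j | j <> i]) E n j).
    by rewrite closedC; apply: bigcup_open.
  apply/seteqP; split=> y [Cy]; rewrite -/C.
    move=> Eny; split=> // -[j /= ji Ejy]; apply: ji.
    by apply: (@E_disjoint n); exists y.
  have [j _ Ejy] := connected_component_sub Cy.
  move=> nEy; split=> //; have [<-//|ji] := pselect (j = i).
  by case: nEy; exists j.
Qed.

(** The end with label [i] sends a compact [K] to the component of its complement that contains
    [E n i] for large [n]. The existential avoids choosing [n] and [x], and the conjunct [compact K]
    gives the empty value that [ends] demands elsewhere. *)
Let end_of (i : I) (K : set Y) : set Y :=
  [set y | compact K /\ exists n x,
    [/\ \bigcup_i E n i `<=` ~` K, E n i x & connected_component (~` K) x y]].

(** Two admissible pairs give the same component: the larger of the two nested sets is connected,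
    misses [K] and contains both points. *)
Let end_ofE i K n x : compact K -> \bigcup_i E n i `<=` ~` K -> E n i x ->
  end_of i K = connected_component (~` K) x.
Proof.
move=> Kc nK Ex; apply/seteqP; split=> y; last by split=> //; exists n, x.
move=> [_ [m [x' [mK Ex' x'y]]]]; apply: (connected_component_trans _ x'y).
have EK k : E k i `<=` \bigcup_i E k i by move=> z; exists i.
have [nm|/ltnW mn] := leqP n m.
  have E'x' := E_decr nm Ex'; have E'K := subset_trans (@EK n) nK.
  exact: (connected_component_max Ex E'K).
have E'x := E_decr mn Ex; have E'K := subset_trans (@EK m) mK.
exact: (connected_component_max E'x E'K).
Qed.

Let end_of_cocompact i n : end_of i (~` \bigcup_i E n i) = E n i.
Proof.
have [x Ex] := E_neq0 n i.
rewrite (end_ofE (@E_cocompact n) _ Ex) setCK//.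
exact: component_bigcup_disjoint_open.
Qed.

(** By [E_escape] the complements of the stages are cofinal among the compact sets, so an end is
    determined by its values there, each of which is one of the [E n i]. *)
Lemma ends_exhaustion_card : (ends Y #= [set: I])%card.
Proof.
have -> : ends Y = end_of @` [set: I].
  apply/seteqP; split=> [e [eC eD e0]|_ [i _ <-]]; last first.
    split=> [K Kc|K L Kc Lc KL|K Knc].
    - have [n nK] := E_escape Kc; have [x Ex] := E_neq0 n i.
      rewrite (end_ofE Kc nK Ex); exists x => //.
      by apply: nK; exists i.
    - have [n nL] := E_escape Lc; have [x Ex] := E_neq0 n i.
      have LK : ~` L `<=` ~` K by apply: subsetC.
      rewrite (end_ofE Lc nL Ex) (end_ofE Kc (subset_trans nL LK) Ex).
      move=> y [C [Cx CL Cc] Cy]; exists C => //; split=> //.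
      exact: subset_trans LK.
    - by rewrite -subset0 => y [].
  have eE n : exists i, e (~` \bigcup_i E n i) = E n i.
    have [x + <-] := eC _ (@E_cocompact n); rewrite setCK => -[i _ Ex].
    by exists i; apply: component_bigcup_disjoint_open.
  have [i ei] := eE 0%N; exists i => //.
  (* The label cannot change with the stage: a point of [E n j] lies in [E 0 j], and by monotonicity
     of [e] also in [E 0 i]. *)
  have {}ei n : e (~` \bigcup_i E n i) = E n i.
    have [j ej] := eE n; rewrite ej; congr (E n _).
    have [x Ex] := E_neq0 n j; apply: (@E_disjoint 0); exists x.
    split; first exact: E_decr Ex.
    rewrite -ei; apply: (eD _ (~` \bigcup_i E n i)) => //.
      by apply: subsetC => y [k _ Ek]; exists k => //; apply: E_decr Ek.
    by rewrite ej.
  apply/funext => K; have [Kc|Knc] := pselect (compact K); last first.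
    by rewrite e0// -subset0 => y [].
  have [n nK] := E_escape Kc; have [x Ex] := E_neq0 n i.
  have eKx : e K x.
    have /(eD _ _ Kc (@E_cocompact n)) : K `<=` ~` \bigcup_i E n i.
      by rewrite -[X in X `<=` _]setCK; apply: subsetC.
    by apply; rewrite ei.
  have [y Ky eK] := eC _ Kc; rewrite (end_ofE Kc nK Ex) -eK.
  by rewrite -eK in eKx; rewrite (same_connected_component eKx).
apply: inj_card_eq => i j _ _ eij; have [x Ex] := E_neq0 0%N i.
by apply: (@E_disjoint 0); exists x; split=> //;
  rewrite -end_of_cocompact -eij end_of_cocompact.
Qed.

End EndsOfExhaustion.

(** * Cyclic covers defined by a cocycle *)

(* [c] is a phantom argument: it selects the topology [twisted_open] below. *)
Definition twisted_product (S : topologicalType) (Q : quotType S)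
  (G : finZmodType) (c : S -> G) : Type := (Q * G)%type.

Section TwistedProduct.
Local Open Scope ring_scope.
Variables (S : topologicalType) (Q0 : quotType S) (G : finZmodType).
Variable c : S -> G.
Local Notation Q := (quotient_topology Q0).
Local Notation pi := (\pi_Q : S -> Q)%qT.
Local Notation Y := (@twisted_product S Q0 G c).

(** The finest topology making all the maps [sheet k] continuous. If [z] and [w] are identified in
    [Q], then [sheet k z = sheet (k + c z - c w) w], so crossing the gluing from [z] to [w] adds
    [c z - c w] to the sheet number. *)
Definition twisted_open (W : set Y) : Prop :=
  forall k : G, open [set z | W (pi z, k + c z)].

Lemma twisted_openT : twisted_open setT.
Proof. by move=> k; exact: (@openT S). Qed.

Lemma twisted_openI : setI_closed twisted_open.
Proof. by move=> A B oA oB k; exact: (openI (oA k) (oB k)). Qed.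

Lemma twisted_open_bigcup (I : Type) (f : I -> set Y) :
  (forall i, twisted_open (f i)) -> twisted_open (\bigcup_i f i).
Proof.
move=> of_ k.
apply: (@bigcup_open _ _ setT (fun i => [set z | f i (pi z, k + c z)])).
by move=> i _; apply: of_.
Qed.

HB.instance Definition _ := Choice.copy Y (Q * G)%type.
HB.instance Definition _ := isOpenTopological.Build Y
  twisted_openT twisted_openI twisted_open_bigcup.

Lemma twisted_openE (W : set Y) :
  open W = forall k : G, open [set z | W (pi z, k + c z)].
Proof. by []. Qed.

Definition twisted_proj (y : Y) : Q := y.1.
Definition sheet (k : G) (z : S) : Y := (pi z, k + c z).
Definition deck_shift (g : G) (y : Y) : Y := (y.1, y.2 + g).

Lemma sheet_continuous k : continuous (sheet k).
Proof. by apply/continuousP => W oW; apply: oW. Qed.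

Lemma sheet_surj (y : Y) : exists k z, y = sheet k z.
Proof.
case: y => x j; pose z := repr (x : Q); exists (j - c z), z.
by rewrite /sheet subrK /z reprK.
Qed.

Lemma twisted_proj_continuous : continuous twisted_proj.
Proof. by apply/continuousP => U oU; rewrite twisted_openE => k; apply: oU. Qed.

Lemma deck_shift_continuous g : continuous (deck_shift g).
Proof.
apply/continuousP => W oW; rewrite twisted_openE => k; have := oW (k + g).
by under eq_set do rewrite addrAC.
Qed.

Lemma deck_shiftK g : cancel (deck_shift g) (deck_shift (- g)).
Proof. by case=> x j; rewrite /deck_shift /= addrK. Qed.

Lemma deck_shift_deck g : deck_group twisted_proj (deck_shift g).
Proof.
split; last by [].
split; first exact/continuous_subspaceT/deck_shift_continuous.
exists (deck_shift (- g)).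
  exact/continuous_subspaceT/deck_shift_continuous.
split=> // y _; first exact: deck_shiftK.
by rewrite -[g in deck_shift g]opprK deck_shiftK.
Qed.

(* [None] marks the points outside the trivialized set; on that set
   [t \o pi - c] is locally constant. *)
Definition trivializes (t : Q -> option G) : Prop :=
  forall g, open [set z | t (pi z) = Some (c z + g)].

(** The graph of [t + g] over the trivialized set; these graphs are the slices of the covering. *)
Definition trivializing_sheet (t : Q -> option G) (g : G) : set Y :=
  [set y | t y.1 = Some (y.2 - g)].

Section Trivialization.
Variable t : Q -> option G.
Hypothesis tP : trivializes t.

Let U : set Q := [set x | t x != None].
Local Notation V := (trivializing_sheet t).

Lemma trivialized_set_open : open U.
Proof.
rewrite /open /= /quotient_open /=.
rewrite (_ : pi @^-1` U = \bigcup_(g in [set: G])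
    [set z | t (pi z) = Some (c z + g)]).
  by apply: bigcup_open => g _; apply: tP.
apply/seteqP; split=> z; rewrite /U /preimage /=.
  by case tz: (t (pi z)) => [j|//] _; exists (j - c z) => //=; rewrite addrC subrK.
by move=> [g _ /= ->].
Qed.

Lemma trivializing_sheet_open g : open (V g).
Proof.
rewrite twisted_openE => k; have := tP (k - g).
by rewrite /trivializing_sheet; under eq_set do rewrite addrCA addrA.
Qed.

Lemma trivializing_sheet_homeomorphism g :
  homeomorphism_between (V g) U twisted_proj.
Proof.
split; first exact/continuous_subspaceT/twisted_proj_continuous.
exists (fun x => (x, odflt 0 (t x) + g)).
  rewrite (continuous_open_subspace _ trivialized_set_open).
  apply/(continuous_inP _ trivialized_set_open) => W oW.
  rewrite /open /= /quotient_open /=.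
  (* Where [t (pi z) = c z + j], the section agrees with [sheet (j + g)], which is continuous by the
     choice of topology. *)
  rewrite [X in open X](_ : _ = \bigcup_(j in [set: G])
      ([set z | t (pi z) = Some (c z + j)] `&`
       [set z | W (pi z, j + g + c z)])).
    by apply: bigcup_open => j _; apply: openI; [exact: tP|exact: oW].
  apply/seteqP; split=> z; rewrite /U /preimage /=.
    case tz: (t (pi z)) => [j|] [//= _ Wz]; exists (j - c z) => //=.
    by rewrite addrC subrK; split=> //; rewrite addrAC subrK.
  move=> [j _ [/= -> Wz]]; split=> //=.
  by rewrite -addrA addrC.
split.
- by move=> y; rewrite /trivializing_sheet /U /twisted_proj /= => ->.
- move=> x; rewrite /trivializing_sheet /U /=; case: (t x) => [j|//] _ /=; by rewrite addrK.
- case=> x j; rewrite inE /trivializing_sheet /twisted_proj /= => -> /=.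
  by rewrite subrK.
- by [].
Qed.

Lemma trivialized_evenly_covered : evenly_covered twisted_proj U.
Proof.
exists (range V); split.
- apply/seteqP; split=> [[x k]|[x k] [_ [g _ <-]]].
    rewrite /U /twisted_proj /preimage /=.
    case tx: (t x) => [j|//] _; exists (V (k - j)); first by exists (k - j).
    by rewrite /trivializing_sheet /= tx opprB addrC subrK.
  by rewrite /trivializing_sheet /U /twisted_proj /preimage /= => ->.
- move=> _ _ [g _ <-] [g' _ <-] [y []]; rewrite /trivializing_sheet /= => -> [].
  by move=> /addrI/oppr_inj ->.
- move=> _ [g _ <-]; split; first exact: trivializing_sheet_open.
  exact: trivializing_sheet_homeomorphism.
Qed.

Lemma trivializing_sheet_connected g : connected U -> connected (V g).
Proof.
move=> Uconn.
have [_ [s scont [_ sV sK _]]] := trivializing_sheet_homeomorphism g.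
suff -> : V g = s @` U by apply: connected_continuous_connected.
apply/seteqP; split=> [y Vy|_ [x Ux <-]]; last exact: sV.
exists (twisted_proj y); last by apply: sK; rewrite inE.
by move: Vy; rewrite /trivializing_sheet /U /twisted_proj /= => ->.
Qed.

End Trivialization.

(** * Connectedness and deck group of the twisted product *)

Section CoveringSpace.
Hypothesis S_connected : connected [set: S].
Hypothesis locally_trivial : forall x : Q,
  exists2 t, trivializes t & t x != None.

Lemma twisted_covering_map : covering_map twisted_proj.
Proof.
split; first exact: twisted_proj_continuous.
  by move=> x _; exists (x, 0).
move=> x; have [t tP tx] := locally_trivial x.
exists [set x | t x != None]; last exact: trivialized_evenly_covered.
by split=> //; apply: trivialized_set_open.
Qed.

Variables (a : G) (z0 z1 : S).
Hypothesis G_cyclic : forall g : G, exists m, g = a *+ m.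
Hypothesis z01 : pi z0 = pi z1.
Hypothesis cz01 : c z0 = a + c z1.

(** Each sheet is an image of the connected [S], and [sheet k z0 = sheet (k + a) z1] links sheet [k]
    to sheet [k + a]; since [a] generates [G], all sheets are linked. *)
Lemma twisted_connected : connected [set: Y].
Proof.
pose C := connected_component [set: Y] (sheet 0 z0).
have sheetC k z : C (sheet k z) -> forall w, C (sheet k w).
  move=> Ckz w; apply: (connected_component_trans Ckz).
  have : connected (range (sheet k)).
    apply: connected_continuous_connected => //.
    exact/continuous_subspaceT/sheet_continuous.
  move=> rangeC; apply: (@connected_component_max _ _ (range (sheet k))) => //.
have C0 m : C (sheet (a *+ m) z0).
  elim: m => [|m IHm]; first exact: connected_component_refl.
  apply: (sheetC _ z1); move: IHm.
  by rewrite /sheet z01 cz01 mulrSr addrA.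
suff CT : C = [set: Y] by rewrite -CT; apply: component_connected.
apply/seteqP; split=> // y _; have [k [z ->]] := sheet_surj y.
by have [m ->] := G_cyclic k; apply: (sheetC _ z0).
Qed.


(** A deck transformation is a lift of the projection, so it equals the shift with the same value at
    [sheet 0 z0]. *)
Lemma deck_groupE : deck_group twisted_proj = range deck_shift.
Proof.
apply/seteqP; split=> [f [[fcont _] pf]|_ [g _ <-]]; last first.
  exact: deck_shift_deck.
have fy0 : (f (sheet 0 z0)).1 = pi z0.
  by rewrite -[LHS]/((twisted_proj \o f) (sheet 0 z0)) pf.
exists ((f (sheet 0 z0)).2 - c z0) => //.
apply: (covering_lift_unique (z0 := sheet 0 z0) twisted_covering_map) => //.
- exact: twisted_connected.
- exact: deck_shift_continuous.
- exact/continuous_subspace_setT.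
by rewrite [RHS]surjective_pairing fy0 /deck_shift /= add0r addrC subrK.
Qed.

Lemma twisted_finite_abelian_cover : finite_abelian_cover twisted_proj.
Proof.
split; first exact: twisted_connected.
- split=> [|[x j] [x' j']]; first exact: twisted_covering_map.
  rewrite /twisted_proj /= => <-; exists (deck_shift (j' - j)).
    exact: deck_shift_deck.
  by rewrite /deck_shift /= addrC subrK.
- by rewrite deck_groupE; apply: finite_image; apply: finite_finset.
- move=> f f'; rewrite deck_groupE !inE => -[g _ <-] [g' _ <-].
  by apply/funext => y; rewrite /deck_shift /= addrAC.
Qed.

End CoveringSpace.

(** * Ends of the twisted product *)

Section Ends.
Variable t : nat -> Q -> option G.
Hypothesis t_trivializes : forall n, trivializes (t n).
Hypothesis t_decr : forall m n x g, (m <= n)%N -> t n x = Some g -> t m x = Some g.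
Hypothesis t_connected : forall n, connected [set x | t n x != None].
Hypothesis t_neq0 : forall n, [set x | t n x != None] !=set0.
Hypothesis t_cocompact : forall n, compact [set z | t n (pi z) = None].
Hypothesis t_escape : forall x : Q, exists n, \forall x' \near x, t n x' = None.

Let E n g := trivializing_sheet (t n) g.

Let bigcupE n : \bigcup_g E n g = [set y | t n y.1 != None].
Proof.
apply/seteqP; split=> [y [g _]|[x k]]; rewrite /E /trivializing_sheet /=.
  by move=> ->.
case tx: (t n x) => [j|//] _; exists (k - j) => //=.
by rewrite tx opprB addrC subrK.
Qed.

(** The stages are the graphs of [t n + g]; [t_decr] preserves values, so the label [g] keeps its
    meaning from stage to stage. *)
Lemma twisted_ends_card : (ends Y #= [set: G])%card.
Proof.
apply: (@ends_exhaustion_card _ _ E).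
- by move=> n g; apply: trivializing_sheet_open.
- by move=> n g; apply: trivializing_sheet_connected.
- move=> n g; have [x /=] := t_neq0 n; case tx: (t n x) => [j|//] _.
  by exists (x, j + g); rewrite /E /trivializing_sheet /= addrK.
- move=> n g g' [y []]; rewrite /E /trivializing_sheet /= => -> [].
  by move=> /addrI/oppr_inj.
- by move=> m n g mn y; apply: t_decr.
- move=> n; rewrite bigcupE.
  (* Since [G] is finite, this is a finite union of continuous images of a compact set. *)
  have -> : ~` [set y : Y | t n y.1 != None] =
      \big[setU/set0]_(k : G) (sheet k @` [set z | t n (pi z) = None]).
    rewrite -bigcup_seq; apply/seteqP; split=> [y /negP/negPn/eqP|y [k _ [z tz <-]]].
      have [k [z ->]] := sheet_surj y; rewrite /sheet /= => tz.
      by exists k; [rewrite /= mem_index_enum|exists z].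
    by rewrite /sheet /= tz.
  apply: bigsetU_compact => k _; apply: continuous_compact => //.
  exact/continuous_subspaceT/sheet_continuous.
(* [t_escape] gives a stage near each point; compactness of [K] makes it uniform, as escaping at one
   stage implies escaping at all later ones. *)
- move=> K /compact_near_coveringP.
  move=> /(_ nat \oo (fun n y => t n y.1 = None)).
  have cover (y : Y) : K y -> \forall y' \near y & n \near \oo, t n y'.1 = None.
    move=> _; have [n tn] := t_escape y.1.
    have py : \forall y' \near y, t n y'.1 = None.
      exact: (@twisted_proj_continuous y _ tn).
    exists ([set y' : Y | t n y'.1 = None], [set m | (n <= m)%N]) => /=.
      by split=> //; exists n.
    move=> [y' m] /= [tn0 nm]; case tm: (t m y'.1) => [g|//].
    by rewrite (t_decr nm tm) in tn0.
  move=> /(_ _ cover)[n _ tK]; exists n; rewrite bigcupE => y /= ty Ky.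
  by move: ty; rewrite (tK n) //=.
Qed.

End Ends.

End TwistedProduct.

(** * The missing points of the square *)

Section ChamanaraCusps.
Local Open Scope ring_scope.
Variable R : realType.
Implicit Types (p q : R * R) (r s t : R) (b e : bool) (i j n : nat).

Local Notation dy n := ((2 : R) ^- n).

Lemma dyadic_gt0 n : 0 < dy n.
Proof. by rewrite invr_gt0 exprn_gt0. Qed.

Lemma dyadicS n : dy n = dy n.+1 + dy n.+1.
Proof. by rewrite exprS invfM -mulrDl; lra. Qed.

Lemma dyadic_le m n : (m <= n)%N -> dy n <= dy m.
Proof. by move=> mn; rewrite lef_pV2 ?posrE ?exprn_gt0// ler_weXn2l// ler1n. Qed.

Lemma dyadic_le1 n : dy n <= 1.
Proof. by have := dyadic_le (leq0n n); rewrite expr0 invr1. Qed.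

Lemma dyadic_small r : 0 < r -> exists n, dy n < r.
Proof.
move=> r0; have := archi_boundP (ltW (_ : 0 < r^-1)); rewrite invr_gt0 => /(_ r0).
set n := Num.bound _ => rn; exists n; rewrite invf_plt ?posrE ?exprn_gt0//.
apply: (lt_trans rn); rewrite -natrX ltr_nat; exact: ltn_expl.
Qed.

Lemma dyadic_interval s : 0 < s -> s <= 1 -> exists j, dy j.+1 < s <= dy j.
Proof.
move=> s0 s1; have := dyadic_small s0 => -[n sn].
elim: n sn => [|n IHn] sn; first by move: sn; rewrite expr0 invr1; lra.
by have [/IHn//|sn'] := ltP (dy n) s; exists n; rewrite sn.
Qed.

Definition swap_if b p : R * R := if b then (p.2, p.1) else p.

(* For [0 < t < 2 ^- j.+1] these are two glued points, on the left and right
   edges of index [j.+1]; [swap_if true] moves them to the bottom and top. *)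
Definition low_side j t : R * R := (0, 1 - dy j + t).
Definition high_side j t : R * R := (1, dy j.+1 + t).

Lemma swap_ifK b : involutive (swap_if b).
Proof. by case: b => -[]. Qed.

Definition open_square p := [&& 0 < p.1, p.1 < 1, 0 < p.2 & p.2 < 1].

Lemma square_with_edgesP p : square_with_edges p <->
  open_square p \/ exists b j t, [/\ 0 < t, t < dy j.+1 &
    p = swap_if b (low_side j t) \/ p = swap_if b (high_side j t)].
Proof.
rewrite /open_square; split; last first.
  case=> [/and4P[? ? ? ?]|[b [j [t [t0 tj pE]]]]].
    by left; split; rewrite /= in_itv/=; apply/andP.
  right; exists j.+1 => //; have djS := dyadicS j.
  case: b pE => -[] ->; rewrite /swap_if /low_side /high_side.
  - by right; left; split=> //=; rewrite in_itv/=; apply/andP; split; lra.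
  - by right; right; split=> //=; rewrite in_itv/=; apply/andP; split; lra.
  - by left; left; split=> //=; rewrite in_itv/=; apply/andP; split; lra.
  - by left; right; split=> //=; rewrite in_itv/=; apply/andP; split; lra.
case: p => x y [[/=]|[[//|j] _ /=]].
  by rewrite !in_itv/= => /andP[? ?] /andP[? ?]; left; apply/and4P.
have djS := dyadicS j; move=> H; right; move: H.
case=> -[] [/=]; rewrite in_itv/=.
- move=> -> /andP[? ?]; exists false, j, (y - (1 - dy j)).
  by split; [lra|lra|left; rewrite /swap_if/low_side; congr pair; lra].
- move=> -> /andP[? ?]; exists false, j, (y - dy j.+1).
  by split; [lra|lra|right; rewrite /swap_if/high_side; congr pair; lra].
- move=> /andP[? ?] ->; exists true, j, (x - (1 - dy j)).
  by split; [lra|lra|left; rewrite /swap_if/low_side/=; congr pair; lra].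
- move=> /andP[? ?] ->; exists true, j, (x - dy j.+1).
  by split; [lra|lra|right; rewrite /swap_if/high_side/=; congr pair; lra].
Qed.

Lemma gluedP (z w : @square_with_edges R) : glued z w <->
  exists b j t, [/\ 0 < t, t < dy j.+1,
    val z = swap_if b (low_side j t) & val w = swap_if b (high_side j t)].
Proof.
split=> [[[//|j] _ /=]|[b [j [t [t0 tj zE wE]]]]]; have djS := dyadicS j.
  case=> -[] [/=]; rewrite in_itv/=.
    move=> z0 /andP[? ?] _ ->; exists false, j, ((val z).2 - (1 - dy j)).
    split; [lra|lra| |].
      rewrite /swap_if/low_side [LHS]surjective_pairing z0.
      by congr pair; lra.
    by rewrite /swap_if/high_side [val z]surjective_pairing z0/=; congr pair => /=; lra.
  move=> /andP[? ?] z0 _ ->; exists true, j, ((val z).1 - (1 - dy j)).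
  split; [lra|lra| |].
    rewrite /swap_if/low_side [LHS]surjective_pairing z0.
    by congr pair => /=; lra.
  by rewrite /swap_if/high_side [val z]surjective_pairing z0/=; congr pair => /=; lra.
exists j.+1 => //; rewrite zE wE; case: b {zE wE}.
  right; split=> /=; first by split=> //=; rewrite in_itv/=; apply/andP; split; lra.
    by split=> //=; rewrite in_itv/=; apply/andP; split; lra.
  by congr pair => /=; lra.
left; split=> /=; first by split=> //=; rewrite in_itv/=; apply/andP; split; lra.
  by split=> //=; rewrite in_itv/=; apply/andP; split; lra.
by congr pair => /=; lra.
Qed.

(** The endpoints of the edges, with the corners (0, 0) and (1, 1) at [j = 0]. The corners (0, 1)
    and (1, 0) are not of this form, but as limits of such points they belong to every [cusp r] with
    [r > 0]. *)
Definition missing_point b e j : R * R :=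
  swap_if b (if e then (1, dy j) else (0, 1 - dy j)).

Definition cusp r p := exists b e j, ball (missing_point b e j) r p.

Lemma ball_pairE p r q : ball p r q <-> `|p.1 - q.1| < r /\ `|p.2 - q.2| < r.
Proof. by []. Qed.

Lemma cusp_swap_if r b p : cusp r (swap_if b p) <-> cusp r p.
Proof.
suff sub q : cusp r q -> cusp r (swap_if b q).
  by split=> [/sub|/sub//]; rewrite swap_ifK.
move=> [b' [e [j]]] /ball_pairE[q1 q2]; exists (b (+) b'), e, j; apply/ball_pairE.
by move: q1 q2; rewrite /missing_point; case: b; case: b' => /=; case: e.
Qed.

(* A missing point nearest to a point of an edge is an endpoint of that edge;
   as gluing maps endpoints to endpoints, [cusp r] is saturated. *)
Lemma cusp_low_side r j t : r <= 1 -> 0 < t -> t < dy j.+1 ->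
  cusp r (low_side j t) <-> t < r \/ dy j.+1 - t < r.
Proof.
move=> r1 t0 tj; have djS := dyadicS j; have dj1 := dyadic_le1 j; split.
  move=> [b [e [i]]] /ball_pairE; rewrite /missing_point /low_side.
  case: b; case: e => /=; rewrite !ltr_norml => -[/andP[? ?] /andP[? ?]].
  - by right; lra.
  - by left; lra.
  - by exfalso; lra.
  - have [ij|ji] := leqP i j; first by left; have := dyadic_le ij; lra.
    by right; have := dyadic_le ji; lra.
case=> ?; [exists false, false, j|exists false, false, j.+1]; apply/ball_pairE;
  rewrite /missing_point /low_side /= !ltr_norml;
  by split; apply/andP; split; lra.
Qed.

(** The central symmetry of the square permutes the missing points and exchanges low and high sides,
    so the high sides need no case analysis of their own. *)
Lemma cusp_reflect r p : cusp r p -> cusp r (1 - p.1, 1 - p.2).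
Proof.
move=> [b [e [j /ball_pairE[]]]] m1 m2; exists b, (~~ e), j; apply/ball_pairE.
by move: b e m1 m2 => [] []; rewrite /missing_point /= !ltr_norml;
  move=> /andP[? ?] /andP[? ?]; split; apply/andP; split; lra.
Qed.

Lemma high_side_reflect j t :
  high_side j t = (1 - (low_side j (dy j.+1 - t)).1, 1 - (low_side j (dy j.+1 - t)).2).
Proof.
by have djS := dyadicS j; rewrite /high_side/low_side/=; congr pair; lra.
Qed.

Lemma cusp_high_side r j t : r <= 1 -> 0 < t -> t < dy j.+1 ->
  cusp r (high_side j t) <-> t < r \/ dy j.+1 - t < r.
Proof.
move=> r1 t0 tj; have := @cusp_low_side r j (dy j.+1 - t) r1.
rewrite subr_gt0 tj ltrBlDl ltrDr t0 subKr => /(_ isT isT) H.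
have -> : (t < r \/ dy j.+1 - t < r) <-> (dy j.+1 - t < r \/ t < r).
  by split=> -[]; [right|left|right|left].
split; last by move=> /(iffRL H)/cusp_reflect; rewrite -high_side_reflect.
move=> /cusp_reflect; rewrite high_side_reflect => c; apply/H.
by move: c; rewrite /= !subKr.
Qed.

Lemma square_avoids_cusp p : square_with_edges p ->
  exists2 r, 0 < r <= 1 & ~ cusp r p.
Proof.
move=> /square_with_edgesP[/and4P[? ? ? ?]|[b [j [t [t0 tj pE]]]]].
  (* Missing points lie on the boundary of the square, so the distance to that boundary is a safe
     radius. *)
  pose r := Num.min (Num.min p.1 (1 - p.1)) (Num.min p.2 (1 - p.2)).
  have [r1 r2 r3 r4] : [/\ r <= p.1, r <= 1 - p.1, r <= p.2 & r <= 1 - p.2].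
    by rewrite /r; split; rewrite !ge_min lexx ?orbT.
  exists r.
    apply/andP; split; last by lra.
    by rewrite /r !lt_min; do !(apply/andP; split); lra.
  move=> [b [e [j /ball_pairE[]]]].
  by move: b e => [] []; rewrite /missing_point /= !ltr_norml;
    move=> /andP[? ?] /andP[? ?]; lra.
pose r := Num.min t (dy j.+1 - t).
have [rt rj] : r <= t /\ r <= dy j.+1 - t.
  by rewrite /r; split; rewrite !ge_min lexx ?orbT.
have := dyadic_le1 j.+1 => dj1.
have r1 : r <= 1 by lra.
exists r; first by rewrite r1 andbT /r lt_min; apply/andP; split; lra.
by case: pE => -> /cusp_swap_if;
  [move=> /(cusp_low_side r1 t0 tj)|move=> /(cusp_high_side r1 t0 tj)];
  case; lra.
Qed.

(** Points of the closed square outside all edges are missing points or one of the two corners to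
    which these accumulate, and a positive radius removes both kinds. This makes the complement of
    [cusp r] a closed part of the closed square. *)
Lemma closed_square_off_cusp r p : 0 < r ->
  0 <= p.1 <= 1 -> 0 <= p.2 <= 1 -> ~ cusp r p -> square_with_edges p.
Proof.
move=> r0.
have side y : 0 <= y <= 1 -> ~ cusp r (0, y) ->
    exists j t, [/\ 0 < t, t < dy j.+1 & (0, y) = low_side j t].
  move=> /andP[y0 y1] nc; have [y1'|y1'] := eqVneq y 1.
    exfalso; apply: nc; have [n nr] := dyadic_small r0.
    exists false, false, n; apply/ball_pairE; rewrite /missing_point /= y1'.
    have := dyadic_gt0 n => ?.
    by rewrite !ltr_norml; split; apply/andP; split; lra.
  have {}y1' : 0 < 1 - y by rewrite subr_gt0 lt_neqAle y1'.
  (* [1 - y] falls in a half-open dyadic interval whose closed end corresponds to a missing point,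
     excluded by [nc]. *)
  have [|j /andP[j1 j2]] := dyadic_interval y1'; first by lra.
  exists j, (y - (1 - dy j)); have djS := dyadicS j; split; [|lra|].
    rewrite lt_neqAle; apply/andP; split; last by lra.
    apply/eqP => tE; apply: nc; exists false, false, j; apply/ball_pairE.
    by rewrite /missing_point /= !ltr_norml; split; apply/andP; split; lra.
  by rewrite /low_side; congr pair; lra.
case: p => x y /= x01 y01 nc; apply/square_with_edgesP.
have [/andP[x0 x1]|xb] := boolP (0 < x < 1); last first.
  right; have [x0|x0] := eqVneq x 0.
    have [|j [t [t0 tj pE]]] := side y y01; first by rewrite -x0.
    by exists false, j, t; split=> //; left; rewrite x0 pE.
  have x1 : x = 1 by move: xb; rewrite lt0r x0; lra.
  have [||j [t [t0 tj [pE]]]] := side (1 - y); first by lra.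
    by move=> /cusp_reflect; rewrite /= subr0 subKr -x1.
  exists false, j, (dy j.+1 - t); split; [lra|lra|right].
  have djS := dyadicS j.
  by rewrite /swap_if/high_side x1; congr pair; lra.
have [/andP[y0 y1]|yb] := boolP (0 < y < 1); first by left; apply/and4P.
have ncs : ~ cusp r (y, x) by move=> c; apply: nc; apply/(cusp_swap_if _ true).
right; have [y0|y0] := eqVneq y 0.
  have [|j [t [t0 tj pE]]] := side x x01; first by rewrite -y0.
  by exists true, j, t; split=> //; left; rewrite -pE y0.
have {}y1 : y = 1 by move: yb; rewrite lt0r y0; lra.
have [||j [t [t0 tj [pE]]]] := side (1 - x); first by lra.
  by move=> /cusp_reflect; rewrite /= subr0 subKr -y1.
exists true, j, (dy j.+1 - t); split; [lra|lra|right].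
have djS := dyadicS j.
by rewrite /swap_if/high_side/= y1; congr pair; lra.
Qed.

End ChamanaraCusps.

(** * Topology of the Chamanara surface *)

(** Open sets of the initial topology are preimages, so a cluster point of the image filter lifts.
    This reduces compactness in the square with edges to compactness in the plane. *)
Lemma compact_initial (S : choiceType) (T : topologicalType) (f : S -> T)
    (A : set (initial_topology f)) :
  compact (f @` A) -> compact A.
Proof.
move=> fA F FF FA.
have fFA : (f @ F) (f @` A) by apply: (@filterS _ F _ A) FA => x Ax; exists x.
have [_ [[x Ax <-] xcl]] := fA _ _ fFA; exists x; split=> // B C FB.
move=> /= [_ [[O oO <-] Ox OC]].
have [||_ [[y By <-] Oy]] := xcl (f @` B) O.
- by apply: (@filterS _ F _ B) FB => y By; exists y.
- exact: open_nbhs_nbhs.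
by exists y; split=> //; apply: OC.
Qed.

Section ChamanaraTopology.
Local Open Scope ring_scope.
Variable R : realType.
Implicit Types (p q m : R * R) (r s t : R) (b e : bool) (i j n : nat).

Local Notation dy n := ((2 : R) ^- n).
Local Notation S := (@square_with_edges R).
Local Notation X := (chamanara R).
Local Notation pi := (\pi_X : S -> X)%qT.

Lemma square_set_open (O : set (R * R)) : open O -> open [set z : S | O (val z)].
Proof. by move=> oO; exists O. Qed.

Lemma chamanara_openE (U : set X) : open U = open [set z : S | U (pi z)].
Proof. by []. Qed.

Lemma chamanara_pi_eq (z w : S) : pi z = pi w -> clos_refl_sym_trans _ (@glued R) z w.
Proof. by move=> /eqmodP /asboolP. Qed.

Lemma pi_glued (z w : S) : glued z w -> pi z = pi w.
Proof. by move=> zw; apply/eqmodP/asboolP; apply: rst_step. Qed.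

Lemma glued_invariant (T : Type) (h : S -> T) (z w : S) :
  (forall z w, glued z w -> h z = h w) -> pi z = pi w -> h z = h w.
Proof.
move=> hinv /chamanara_pi_eq; elim=> [||z' w' _ ->|z' w' v' _ -> _ ->]//.
Qed.

Lemma in_square (p : R * R) : square_with_edges p -> exists z : S, val z = p.
Proof. by move=> /mem_set Sp; exists (exist _ p Sp). Qed.

Lemma square_val (z : S) : square_with_edges (val z).
Proof. exact: set_valP. Qed.

Lemma square_bounds p : square_with_edges p -> 0 <= p.1 <= 1 /\ 0 <= p.2 <= 1.
Proof.
case/square_with_edgesP=> [/and4P[? ? ? ?]|[b [j [t [t0 tj pE]]]]].
  by split; lra.
have := dyadicS R j; have := dyadic_le1 R j; have := dyadic_gt0 R j => ? ? ?.
by case: b pE => -[] ->; rewrite /= ?lexx ?ler01; split=> //; lra.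
Qed.

Lemma open_fst_gt s : open [set p : R * R | s < p.1].
Proof.
apply: (@open_comp _ _ fst [set x | s < x]); last exact: open_gt.
by move=> p _; apply: cvg_fst.
Qed.

Lemma open_fst_lt s : open [set p : R * R | p.1 < s].
Proof.
apply: (@open_comp _ _ fst [set x | x < s]); last exact: open_lt.
by move=> p _; apply: cvg_fst.
Qed.

Lemma open_snd_gt s : open [set p : R * R | s < p.2].
Proof.
apply: (@open_comp _ _ snd [set x | s < x]); last exact: open_gt.
by move=> p _; apply: cvg_snd.
Qed.

Lemma open_snd_lt s : open [set p : R * R | p.2 < s].
Proof.
apply: (@open_comp _ _ snd [set x | x < s]); last exact: open_lt.
by move=> p _; apply: cvg_snd.
Qed.

Lemma swap_if_continuous b : continuous (@swap_if R b).
Proof. by case: b; [exact: swap_continuous|move=> p; exact: cvg_id]. Qed.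

Lemma segment_gt (x y s t : R) :
  t <= x -> t < y -> 0 < s -> s <= 1 -> t < x + s * (y - x).
Proof.
move=> tx ty s0 s1.
have : 0 < s * (y - t) by rewrite mulr_gt0// subr_gt0.
have : 0 <= (1 - s) * (x - t) by rewrite mulr_ge0// subr_ge0.
by lra.
Qed.

Lemma segment_lt (x y s t : R) :
  x <= t -> y < t -> 0 < s -> s <= 1 -> x + s * (y - x) < t.
Proof.
move=> xt yt s0 s1.
have := @segment_gt (- x) (- y) s (- t); rewrite lerN2 ltrN2 => /(_ xt yt s0 s1).
by lra.
Qed.

(** The square with edges is not convex, as a segment along a side can run into missing points, but
    it is star-shaped about each point of the open square. Balls are convex, so contracting to [q]
    stays inside the ball. *)
Lemma ball_square_connected m r q : open_square q -> ball m r q ->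
  connected [set z : S | ball m r (val z)].
Proof.
move=> /and4P[q1 q1' q2 q2'] mq.
have [w wq] : exists w : S, val w = q.
  by apply: in_square; apply/square_with_edgesP; left; apply/and4P.
pose seg (p : R * R) (s : R) : R * R :=
  (p.1 + s * (q.1 - p.1), p.2 + s * (q.2 - p.2)).
have seg0 p : seg p 0 = p by rewrite /seg !mul0r !addr0 -surjective_pairing.
have seg1 p : seg p 1 = q.
  by rewrite /seg !mul1r !(addrC _ (_ - _)) !subrK -surjective_pairing.
have segS p s : square_with_edges p -> 0 <= s <= 1 -> square_with_edges (seg p s).
  move=> Sp /andP[s0 s1]; have [->|s0'] := eqVneq s 0; first by rewrite seg0.
  have {}s0 : 0 < s by rewrite lt0r s0'.
  have [/andP[? ?] /andP[? ?]] := square_bounds Sp.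
  apply/square_with_edgesP; left.
  by apply/and4P; split; [exact: segment_gt|exact: segment_lt|
                          exact: segment_gt|exact: segment_lt].
have segB p s : ball m r p -> 0 <= s <= 1 -> ball m r (seg p s).
  move=> mp /andP[s0 s1]; have [->|s0'] := eqVneq s 0; first by rewrite seg0.
  have {}s0 : 0 < s by rewrite lt0r s0'.
  move: mp mq => /ball_pairE[mp1 mp2] /ball_pairE[mq1 mq2]; apply/ball_pairE.
  move: mp1 mp2 mq1 mq2; rewrite !(distrC m.1) !(distrC m.2) !ltr_distl.
  move=> /andP[? ?] /andP[? ?] /andP[? ?] /andP[? ?].
  by split; apply/andP; split; (apply: segment_gt || apply: segment_lt) => //;
    apply: ltW.
have seg_cont p : continuous (seg p).
  have aff (x y : R) : continuous (fun s : R => x + s * y).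
    by move=> s; apply: cvgD; [exact: cvg_cst|apply: cvgMl; exact: cvg_id].
  move=> s.
  exact: (cvg_pair (aff p.1 (q.1 - p.1) s) (aff p.2 (q.2 - p.2) s)).
(* [w] is a dummy value for parameters outside [0, 1], where the line may leave the square. *)
pose gam (z : S) (s : R) : S := insubd w (seg (val z) s).
have gamE z s : 0 <= s <= 1 -> val (gam z s) = seg (val z) s.
  by move=> s01; rewrite insubdK//; apply/mem_set/segS => //; apply: square_val.
have gamC z : connected (gam z @` `[0, 1]).
  apply: connected_continuous_connected; first exact: segment_connected.
  apply/continuousP => _ [O oO <-]; apply/open_subspaceP.
  exists (seg (val z) @^-1` O).
    by move/continuousP : (seg_cont (val z)); apply.
  suff gO s : `[0, 1]%classic s -> O (seg (val z) s) = O (set_val (gam z s)).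
    apply/seteqP; split=> s [Os s01]; split=> //;
      by move: Os; rewrite /preimage /= gO.
  by rewrite /= in_itv/= => /gamE <-.
rewrite (_ : [set z | _] =
    \bigcup_(z in [set z : S | ball m r (val z)]) (gam z @` `[0, 1])).
  apply: bigcup_connected => // ; exists w => z mz; exists 1.
    by rewrite /= in_itv/= ler01 lexx.
  apply: val_inj; rewrite gamE ?ler01 ?lexx//.
  by rewrite wq seg1.
apply/seteqP; split=> [z mz|_ [z mz [s s01 <-]]].
  exists z => //; exists 0; first by rewrite /= in_itv/= ler01 lexx.
  by apply: val_inj; rewrite gamE ?ler01 ?lexx.
by rewrite /= in_itv/= in s01; rewrite /= gamE//; apply: segB.
Qed.

Lemma square_connected : connected [set: S].
Proof.
pose h : R := 2^-1.
have := @ball_square_connected (h, h) 1 (h, h); rewrite (_ : [set z | _] = setT).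
  by apply; [rewrite /open_square/h/=; apply/and4P; split; lra|exact: ballxx].
apply/seteqP; split=> // z _; apply/ball_pairE; rewrite !ltr_norml /=.
have [/andP[? ?] /andP[? ?]] := square_bounds (square_val z).
by rewrite /h; split; apply/andP; split; lra.
Qed.

Lemma cusp_open r : open (@cusp R r).
Proof.
rewrite openE => p [b [e [j mp]]]; apply: (@filterS _ _ _ (ball (missing_point R b e j) r)).
  by move=> q mq; exists b, e, j.
by apply: open_nbhs_nbhs; split=> //; apply: ball_open; apply: le_lt_trans (ball_ge0 mp).
Qed.

Lemma cusp_complement_compact r : 0 < r -> compact [set z : S | ~ cusp r (val z)].
Proof.
move=> r0; apply: compact_initial.
rewrite (_ : _ @` _ = (`[0, 1] `*` `[0, 1]) `&` ~` cusp r).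
  apply: compact_closedI; last by rewrite closedC; apply: cusp_open.
  by apply: compact_setX; apply: segment_compact.
apply/seteqP; split=> [_ [z nz <-]|[x y] [[/=]]].
  by split=> //; have [p1 p2] := square_bounds (square_val z); split;
    rewrite /= in_itv.
rewrite !in_itv /= => x01 y01 nc.
have [z zE] := in_square (@closed_square_off_cusp R r (x, y) r0 x01 y01 nc).
by exists z => //=; rewrite zE.
Qed.

End ChamanaraTopology.

(** * Connectedness of the neighbourhoods of infinity in X *)

Section CuspImage.
Local Open Scope ring_scope.
Variable R : realType.
Implicit Types (p q m : R * R) (s t : R) (b e : bool) (i j n : nat).

Local Notation dy n := ((2 : R) ^- n).
Local Notation S := (@square_with_edges R).
Local Notation X := (chamanara R).
Local Notation pi := (\pi_X : S -> X)%qT.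

Variable r : R.
Hypotheses (r_gt0 : 0 < r) (r_le1 : r <= 1).

Let N m : set X := pi @` [set z : S | ball m r (val z)].

Let small j : exists t, [/\ 0 < t, t < r & t < dy j.+1].
Proof.
have dj := dyadic_gt0 R j.+1; exists (Num.min r (dy j.+1) / 2).
have m0 : 0 < Num.min r (dy j.+1) by rewrite lt_min r_gt0.
have [m1 m2] : Num.min r (dy j.+1) <= r /\ Num.min r (dy j.+1) <= dy j.+1.
  by split; rewrite ge_min lexx ?orbT.
by split; lra.
Qed.

Let ball_swap_if m p b s : ball (swap_if b m) s (swap_if b p) <-> ball m s p.
Proof. by case: b => //; split=> -[]. Qed.

Let N_connected b e j : connected (N (missing_point R b e j)).
Proof.
have djS := dyadicS R j; have dj1 := dyadic_le1 R j.
have [t [t0 tr tj]] := small j.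
apply: connected_continuous_connected; last first.
  exact/continuous_subspaceT/pi_continuous.
apply: (@ball_square_connected _ _ _
    (swap_if b (if e then (1 - t, dy j - t) else (t, 1 - dy j + t)))).
  by case: b; case: e; apply/and4P; split => /=; lra.
rewrite /missing_point; apply/ball_swap_if/ball_pairE.
by case: e; rewrite /= !ltr_norml; split; apply/andP; split; lra.
Qed.

Let N_meet b j t m m' : 0 < t -> t < dy j.+1 ->
  ball m r (swap_if b (low_side j t)) -> ball m' r (swap_if b (high_side j t)) ->
  N m `&` N m' !=set0.
Proof.
move=> t0 tj ml mh.
have [z zE] : exists z : S, val z = swap_if b (low_side j t).
  apply: in_square; apply/square_with_edgesP; right; exists b, j, t.
  by split=> //; left.
have [w wE] : exists w : S, val w = swap_if b (high_side j t).
  apply: in_square; apply/square_with_edgesP; right; exists b, j, t.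
  by split=> //; right.
exists (pi z); split; first by exists z; rewrite //= zE.
by exists w; [rewrite /= wE|symmetry; apply: pi_glued; apply/gluedP; exists b, j, t].
Qed.

(** Gluing the edges of index [j.+1] matches lower endpoint with lower and upper with upper. Indices
    increase upwards on the low side and downwards on the high side, so index [j] on one side meets
    index [j.+1] on the other. *)
Let N_adjacent b e j :
  N (missing_point R b e j) `&` N (missing_point R b (~~ e) j.+1) !=set0.
Proof.
have djS := dyadicS R j; have [t [t0 tr tj]] := small j.
case: e => /=; last first.
  apply: (N_meet (b := b) t0 tj); rewrite /missing_point; apply/ball_swap_if/ball_pairE;
    by rewrite /low_side/high_side /= !ltr_norml; split; apply/andP; split; lra.
rewrite setIC; apply: (@N_meet b j (dy j.+1 - t)); [lra|lra| |];
  rewrite /missing_point; apply/ball_swap_if/ball_pairE;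
  by rewrite /low_side/high_side /= !ltr_norml; split; apply/andP; split; lra.
Qed.

(** The link between the two chains of [cusp_image_connected]: consecutive missing points on one
    side belong to different chains, and for large [n] they are less than [r] apart. *)
Let N_overlap n : dy n < r ->
  N (missing_point R false false n) `&` N (missing_point R false false n.+1) !=set0.
Proof.
move=> nr; have dnS := dyadicS R n; have dn0 := dyadic_gt0 R n.+1.
have dn1 := dyadic_le1 R n.
have [z zE] : exists z : S, val z = (r / 2, 1 - dy n.+1).
  apply: in_square; apply/square_with_edgesP; left.
  by move: r_le1 => r1; apply/and4P; split => /=; lra.
exists (pi z); split; exists z => //=; rewrite zE; apply/ball_pairE;
  by rewrite /missing_point /= !ltr_norml; split; apply/andP; split; lra.
Qed.

(* The gluings link the neighbourhoods of [missing_point b e j] into two chains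
   [alt b e], in which the side alternates, that start at the corners (0, 0)
   and (1, 1).  Far enough along, a neighbourhood from one chain overlaps a
   neighbourhood from the other one. *)
Lemma cusp_image_connected : connected (pi @` [set z : S | cusp r (val z)]).
Proof.
set U := pi @` _.
have NU b e j : N (missing_point R b e j) `<=` U.
  by move=> _ [z mz <-]; exists z => //; exists b, e, j.
have [x0 [x0N _]] := N_adjacent false false 0.
pose C := connected_component U x0.
pose alt b e j := missing_point R b (e (+) odd j) j.
have step b e j b' e' j' :
    N (missing_point R b e j) `&` N (missing_point R b' e' j') !=set0 ->
    N (missing_point R b e j) `<=` C -> N (missing_point R b' e' j') `<=` C.
  move=> [y [Ny N'y]] /(_ _ Ny) Cy x N'x; apply: (connected_component_trans Cy).
  exact: (connected_component_max N'y (@NU b' e' j') (@N_connected b' e' j')).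
have chain b e j : N (alt b e j) `<=` C <-> N (alt b e 0%N) `<=` C.
  elim: j => // j <-; have adj := @N_adjacent b (e (+) odd j) j.
  rewrite /alt oddS addbN; split; apply: step => //.
  by rewrite setIC.
(* At [j = 0] both values of [b] give the same corner, so the four chains start at only two
   points. *)
have alt0 b e : alt b e 0%N = alt false e 0%N.
  by rewrite /alt /missing_point expr0 invr1 subrr; case: b; case: e.
have C00 : N (alt false false 0%N) `<=` C.
  move=> x Nx; apply: (@connected_component_max _ _ _ _ x0N _ (@N_connected false false 0%N)) => //.
have C0 e : N (alt false e 0%N) `<=` C.
  have [n nr] := dyadic_small r_gt0; have ov := N_overlap nr.
  have altn : alt false (odd n) n = missing_point R false false n.
    by rewrite /alt addbb.
  have altS : alt false (~~ odd n) n.+1 = missing_point R false false n.+1.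
    by rewrite /alt oddS addbb.
  have H : N (alt false (odd n) 0%N) `<=` C <-> N (alt false (~~ odd n) 0%N) `<=` C.
    rewrite -(chain false (odd n) n) -(chain false (~~ odd n) n.+1) altn altS.
    by split; apply: step => //; rewrite setIC.
  by case: (odd n) H e => -[H1 H2] [] //; [exact: H2|exact: H1].
suff -> : U = C by apply: component_connected.
apply/seteqP; split; last exact: connected_component_sub.
move=> _ [z [b [e [j bz]]] <-].
have := iffRL (chain b (e (+) odd j) j); rewrite alt0 /alt addbK => /(_ (C0 _)).
by apply; exists z.
Qed.

End CuspImage.

(** * The cocycle and its local trivializations *)

Section Cocycle.
Local Open Scope ring_scope.
Variables (R : realType) (G : finZmodType) (a : G).
Implicit Types (p q m : R * R) (r s t : R) (b e : bool) (i j n : nat).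

Local Notation dy n := ((2 : R) ^- n).
Local Notation S := (@square_with_edges R).
Local Notation X := (chamanara R).
Local Notation pi := (\pi_X : S -> X)%qT.

(** In the square with edges, x = 0 and y < 1/2 single out the first left edge, and symmetrically
    for the first bottom edge. Only the low side of a glued pair is charged, so the difference
    between its two sides is the monodromy. *)
Definition cocycle p : G :=
  if (p.1 == 0) && (p.2 < 2^-1) || (p.2 == 0) && (p.1 < 2^-1) then a else 0.

Let dy1 j : dy j.+1 <= 2^-1.
Proof. by have := @dyadic_le R 1 j.+1 isT; rewrite expr1. Qed.

Lemma cocycle_low b j t : 0 < t -> t < dy j.+1 ->
  cocycle (swap_if b (low_side j t)) = if j == 0%N then a else 0.
Proof.
move=> t0 tj; rewrite /cocycle /low_side; have djS := dyadicS R j.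
have dj1 := dyadic_le1 R j.
have y0 : (1 - dy j + t == 0) = false by apply/negP => /eqP; lra.
have -> : (j == 0%N) = (1 - dy j + t < 2^-1).
  case: j tj y0 djS dj1 => [|j] tj _ djS dj1.
    by rewrite expr0 invr1; rewrite expr1 in tj; case: ltP => //=; lra.
  by have := dy1 j; case: ltP => //=; lra.
by case: b; rewrite /= y0 eqxx /= ?orbF.
Qed.

Lemma cocycle_high b j t : 0 < t -> cocycle (swap_if b (high_side j t)) = 0.
Proof.
move=> t0; have dj := dyadic_gt0 R j.+1; rewrite /cocycle /high_side.
have y0 : (dy j.+1 + t == 0) = false by apply/negP => /eqP; lra.
by case: b; rewrite /= y0 oner_eq0.
Qed.

Section LocalTrivialization.
Variables (W : set (R * R)) (u : R * R -> G).
Hypothesis W_open : forall p, W p -> exists O : set (R * R),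
  [/\ open O, O p & forall q, O q -> square_with_edges q -> W q /\ u q = u p].
Hypothesis W_saturated : forall b j t, 0 < t -> t < dy j.+1 ->
  W (swap_if b (low_side j t)) <-> W (swap_if b (high_side j t)).
Hypothesis u_glued : forall b j t, 0 < t -> t < dy j.+1 ->
  W (swap_if b (low_side j t)) ->
  (if j == 0%N then a else 0) + u (swap_if b (low_side j t)) =
  u (swap_if b (high_side j t)).

Let h (z : S) : option G :=
  if `[< W (val z) >] then Some (cocycle (val z) + u (val z)) else None.

(** [u] is a sheet numbering, locally constant on [W]. By [u_glued], [cocycle + u] agrees at glued
    points, so the choice of representative is immaterial. *)
Definition local_trivialization (x : X) : option G := h (repr x).

Lemma local_trivializationE (z : S) : local_trivialization (pi z) = h z.
Proof.
apply: glued_invariant; last by rewrite reprK.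
move=> {}z w /gluedP[b [j [t [t0 tj zE wE]]]].
rewrite /h zE wE cocycle_low// cocycle_high// add0r.
have -> : `[< W (swap_if b (low_side j t)) >] = `[< W (swap_if b (high_side j t)) >].
  exact/asbool_equiv_eq/W_saturated.
case: ifPn => // /asboolP/(W_saturated b t0 tj) Wl.
by rewrite u_glued.
Qed.

Lemma local_trivialization_trivializes :
  @trivializes _ _ G (fun z : S => cocycle (val z)) local_trivialization.
Proof.
move=> g; rewrite openE => z /=; rewrite local_trivializationE /h.
case: ifPn => // /asboolP Wz [/addrI uz].
have [O [oO Oz OW]] := W_open Wz.
apply: (@filterS _ _ _ [set w : S | O (val w)]); last first.
  by apply: open_nbhs_nbhs; split=> //; apply: square_set_open.
move=> w /= /OW/(_ (square_val w))[Ww uw].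
by rewrite local_trivializationE /h asboolT// uw uz.
Qed.

Lemma local_trivialization_neq0 (z : S) :
  (local_trivialization (pi z) != None) = `[< W (val z) >].
Proof. by rewrite local_trivializationE /h; case: ifP. Qed.

End LocalTrivialization.

End Cocycle.

(** * The cover *)

Section ChamanaraCover.
Local Open Scope ring_scope.
Variables (R : realType) (G : finZmodType) (a : G).
Implicit Types (p q m : R * R) (r s t : R) (b e : bool) (i j n : nat).

Local Notation dy n := ((2 : R) ^- n).
Local Notation S := (@square_with_edges R).
Local Notation X := (chamanara R).
Local Notation pi := (\pi_X : S -> X)%qT.
Local Notation c := (fun z : S => cocycle a (val z)).
Local Notation trivial_at x := (exists2 t, @trivializes _ _ G c t & t x != None).

Let dyS_half j : dy j.+1 <= 2^-1.
Proof. by have := @dyadic_le R 1 j.+1 isT; rewrite expr1. Qed.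

(** Within the square this is the complement of the closures of the four first edges: an open set
    where the cocycle vanishes and the constant numbering 0 works. *)
Definition slit_free p : Prop :=
  [/\ 0 < p.1 \/ 2^-1 < p.2, p.1 < 1 \/ p.2 < 2^-1,
      0 < p.2 \/ 2^-1 < p.1 & p.2 < 1 \/ p.1 < 2^-1].

Lemma slit_free_trivial (z : S) : slit_free (val z) -> trivial_at (pi z).
Proof.
move=> sz; pose u := fun _ : R * R => 0 : G.
have sfo p : slit_free p -> exists O : set (R * R),
    [/\ open O, O p & forall q, O q -> square_with_edges q ->
      slit_free q /\ u q = u p].
  move=> sp; exists slit_free; split=> //.
  rewrite (_ : slit_free = (([set p | 0 < p.1] `|` [set p | 2^-1 < p.2]) `&`
      ([set p | p.1 < 1] `|` [set p | p.2 < 2^-1])) `&`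
      (([set p | 0 < p.2] `|` [set p | 2^-1 < p.1]) `&`
      ([set p | p.2 < 1] `|` [set p | p.1 < 2^-1]))).
    by apply: openI; apply: openI; apply: openU;
      (exact: open_fst_gt || exact: open_fst_lt || exact: open_snd_gt ||
       exact: open_snd_lt).
  by apply/seteqP; split=> q; [case|case=> -[? ?] []].
have off b j t : 0 < t -> t < dy j.+1 ->
    (slit_free (swap_if b (low_side j t)) <-> (0 < j)%N) /\
    (slit_free (swap_if b (high_side j t)) <-> (0 < j)%N).
  move=> t0 tj; have djS := dyadicS R j; have dj1 := dyadic_le1 R j.
  have dj0 := dyadic_gt0 R j.+1; have := dyS_half j => djh.
  case: j tj djS dj1 dj0 djh => [|j] tj djS dj1 dj0 djh.
    rewrite expr0 invr1 in djS dj1; rewrite /slit_free /low_side /high_side expr0 invr1.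
    by split; split=> //; case: b => -[] /=; lra.
  have dh := dyS_half j.
  by split; split=> // _; rewrite /slit_free /low_side /high_side;
    case: b => /=; split; try (by left; lra); right; lra.
have saturated b j t : 0 < t -> t < dy j.+1 ->
    slit_free (swap_if b (low_side j t)) <-> slit_free (swap_if b (high_side j t)).
  by move=> t0 tj; have [-> ->] := off b j t t0 tj.
exists (local_trivialization a slit_free u).
  apply: local_trivialization_trivializes => // b j t t0 tj.
  by have [-> _] := off b j t t0 tj; rewrite /u addr0; case: j tj.
rewrite (local_trivialization_neq0 saturated) ?asboolT// => b j t t0 tj.
by have [-> _] := off b j t t0 tj; rewrite /u addr0; case: j tj.
Qed.

(* The two halves of [band b] are neighbourhoods of the first pair of glued
   edges. *)
Definition band b p : Prop := let q := swap_if b p in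
  q.1 < 2^-1 /\ 0 < q.2 < 2^-1 \/ 2^-1 < q.1 /\ 2^-1 < q.2 < 1.

Let band_side b b' j t : 0 < t -> t < dy j.+1 ->
    (band b (swap_if b' (low_side j t)) <-> b = b' /\ j = 0%N) /\
    (band b (swap_if b' (high_side j t)) <-> b = b' /\ j = 0%N).
Proof.
  move=> t0 tj; have djS := dyadicS R j; have dj1 := dyadic_le1 R j.
  have dj0 := dyadic_gt0 R j.+1.
  rewrite /band /low_side /high_side.
  have [<-|bb'] := eqVneq b b'; last first.
    split; split=> [|[/eqP]]; rewrite ?(negPf bb')//.
      by case: b b' bb' => -[] //= _ H; exfalso; move: H; lra.
    by case: b b' bb' => -[] //= _ H; exfalso; move: H; lra.
  rewrite !swap_ifK /=; case: j tj djS dj1 dj0 => [|j] tj djS dj1 dj0.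
    rewrite expr0 invr1 in djS dj1 *.
    by split; split=> // _; [left|right]; split; lra.
  have dh := dyS_half j.
  by split; split=> [H|[]//]; exfalso; move: H; lra.
Qed.

Lemma band_trivial b (z : S) : band b (val z) -> trivial_at (pi z).
Proof.
(* The value [a] on the high half balances the cocycle on the first low edge. *)
move=> bz; pose u p : G := if 2^-1 < (swap_if b p).1 then a else 0.
have bo p : band b p -> exists O : set (R * R),
    [/\ open O, O p & forall q, O q -> square_with_edges q ->
      band b q /\ u q = u p].
  case=> -[p1 /andP[p2 p2']].
    exists (swap_if b @^-1` ([set p | p.1 < 2^-1] `&`
      ([set p | 0 < p.2] `&` [set p | p.2 < 2^-1]))); split=> //.
      apply: open_comp => [? _|]; first exact: swap_if_continuous.
      by apply: openI; [exact: open_fst_lt|apply: openI;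
        [exact: open_snd_gt|exact: open_snd_lt]].
    move=> q [/= q1 [q2 q2']] _; split; first by left; rewrite q1 q2.
    by rewrite /u (lt_gtF p1) (lt_gtF q1).
  exists (swap_if b @^-1` ([set p | 2^-1 < p.1] `&`
    ([set p | 2^-1 < p.2] `&` [set p | p.2 < 1]))); split=> //.
    apply: open_comp => [? _|]; first exact: swap_if_continuous.
    by apply: openI; [exact: open_fst_gt|apply: openI;
      [exact: open_snd_gt|exact: open_snd_lt]].
  move=> q [/= q1 [q2 q2']] _; split; first by right; rewrite q1 q2.
  by rewrite /u p1 q1.
have saturated b' j t : 0 < t -> t < dy j.+1 ->
    band b (swap_if b' (low_side j t)) <-> band b (swap_if b' (high_side j t)).
  by move=> t0 tj; have [-> ->] := band_side b b' t0 tj.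
have glue b' j t : 0 < t -> t < dy j.+1 -> band b (swap_if b' (low_side j t)) ->
    (if j == 0%N then a else 0) + u (swap_if b' (low_side j t)) =
    u (swap_if b' (high_side j t)).
  move=> t0 tj; have [-> _] := band_side b b' t0 tj => -[<- ->].
  rewrite /u !swap_ifK /low_side /high_side /=.
  by rewrite ifF ?ifT ?addr0//; [lra|apply/negP; lra].
exists (local_trivialization a (band b) u).
  exact: local_trivialization_trivializes.
by rewrite (local_trivialization_neq0 saturated glue) asboolT.
Qed.

(** The bands cover the first edges, and [slit_free] covers everything else. *)
Lemma chamanara_locally_trivial (x : X) : trivial_at x.
Proof.
suff loc (z : S) : trivial_at (pi z) by have := loc (repr x); rewrite reprK.
have half : 0 < (2^-1 : R) < 1 by apply/andP; split; lra.
have /square_with_edgesP[/and4P[? ? ? ?]|[b [j [t [t0 tj zE]]]]] := square_val z.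
  by apply: slit_free_trivial; split; left.
have djS := dyadicS R j; have dj1 := dyadic_le1 R j; have dj0 := dyadic_gt0 R j.+1.
case: j tj djS dj1 dj0 zE => [|j] tj djS dj1 dj0 zE.
  apply: (@band_trivial b); rewrite /band; rewrite expr0 invr1 in djS dj1.
  by case: zE => ->; rewrite swap_ifK /low_side /high_side /= ?expr0 ?invr1; [left|right]; split; lra.
have dh := dyS_half j; apply: slit_free_trivial; rewrite /slit_free.
by case: zE => ->; rewrite /low_side /high_side; case: b => /=; split;
  try (by left; lra); right; lra.
Qed.

(* Near the corners (0, 0) and (1, 1) the sheets are renumbered to make
   [cocycle + corner_shift] invariant under gluing on [cusp r]. *)
Definition corner_shift p : G :=
  if (p.1 < 4^-1) && (p.2 < 4^-1) then - a
  else if (3 / 4 < p.1) && (3 / 4 < p.2) then a else 0.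

Lemma corner_shift_swap_if b p : corner_shift (swap_if b p) = corner_shift p.
Proof. by case: b => //; rewrite /corner_shift /= andbC [X in if X then a else _]andbC. Qed.

(** The bound 1/4 keeps the balls about the other missing points out of the two corner squares, so
    the shift is constant on each ball. *)
Lemma corner_shift_ball r b e j q : r <= 4^-1 ->
  ball (missing_point R b e j) r q ->
  corner_shift q = if j == 0%N then if e then a else - a else 0.
Proof.
move=> r4.
suff near_left q' : ball (missing_point R false e j) r q' ->
    corner_shift q' = if j == 0%N then if e then a else - a else 0.
  case: b; last exact: near_left.
  by rewrite -(corner_shift_swap_if true q) => -[? ?]; apply: near_left; split.
move=> /ball_pairE[]; rewrite /corner_shift /missing_point /=.
have dj0 := dyadic_gt0 R j; have dh := dyS_half j.-1.
case: e; case: j dj0 dh => [|j] dj0 /= dh; rewrite !ltr_norml ?expr0 ?invr1;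
  move=> /andP[? ?] /andP[? ?].
- by rewrite ifF ?ifT//; [apply/andP; split; lra|apply/negP => /andP[]; lra].
- by rewrite !ifF//; apply/negP => /andP[]; lra.
- by rewrite ifT//; apply/andP; split; lra.
- by rewrite !ifF//; apply/negP => /andP[]; lra.
Qed.

Lemma cusp_sides r b j t : r <= 1 -> 0 < t -> t < dy j.+1 ->
  (cusp r (swap_if b (low_side j t)) <-> t < r \/ dy j.+1 - t < r) /\
  (cusp r (swap_if b (high_side j t)) <-> t < r \/ dy j.+1 - t < r).
Proof.
move=> r1 t0 tj; split.
  exact: iff_trans (cusp_swap_if r b _) (cusp_low_side r1 t0 tj).
exact: iff_trans (cusp_swap_if r b _) (cusp_high_side r1 t0 tj).
Qed.

Lemma cusp_saturated r b j t : r <= 1 -> 0 < t -> t < dy j.+1 ->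
  cusp r (swap_if b (low_side j t)) <-> cusp r (swap_if b (high_side j t)).
Proof. by move=> r1 t0 tj; have [-> ->] := cusp_sides b r1 t0 tj. Qed.

Lemma cusp_glued_invariant r (z w : S) : r <= 1 -> pi z = pi w ->
  cusp r (val z) = cusp r (val w).
Proof.
move=> r1; apply: (@glued_invariant _ _ (fun z : S => cusp r (val z))).
move=> {}z {}w /gluedP[b [j [t [t0 tj -> ->]]]].
exact/propext/cusp_saturated.
Qed.

Lemma cusp_le r s p : r <= s -> cusp r p -> cusp s p.
Proof. by move=> rs [b [e [j mp]]]; exists b, e, j; apply: le_ball mp. Qed.

(** Avoiding [cusp r] itself is a closed condition; a larger radius [s] leaves a margin, of which
    half pays for moving the point. *)
Lemma away_from_cusp_open r :
  open [set p : R * R | exists s, [/\ r < s, s <= 1 & ~ cusp s p]].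
Proof.
rewrite openE => p [s [rs s1 ncp]].
have ss : 0 < (s - r) / 2 by lra.
apply: (@filterS _ _ _ (ball p ((s - r) / 2))); last exact: nbhsx_ballx.
move=> q pq; exists ((r + s) / 2); split; [lra|lra|].
move=> [b [e [j mq]]]; apply: ncp; exists b, e, j.
have := ball_triangle mq (ball_sym pq).
by congr (ball _ _ p); lra.
Qed.

Section CuspTrivialization.
Variable r : R.
Hypotheses (r_gt0 : 0 < r) (r_le4 : r <= 4^-1).

Let r_le1 : r <= 1.
Proof. by apply: (le_trans r_le4); lra. Qed.

Definition cusp_trivialization : X -> option G :=
  local_trivialization a (cusp r) corner_shift.

(** Only [j = 0] matters. At the lower end the low side is near (0, 0), where [- a] cancels the
    cocycle, and the high side is unshifted; at the upper end the low side is unshifted and the high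
    side is near (1, 1), where the shift is [a]. *)
Let corner_shift_glued b j t : 0 < t -> t < dy j.+1 ->
  cusp r (swap_if b (low_side j t)) ->
  (if j == 0%N then a else 0) + corner_shift (swap_if b (low_side j t)) =
  corner_shift (swap_if b (high_side j t)).
Proof.
move=> t0 tj; rewrite (cusp_sides b r_le1 t0 tj).1 !corner_shift_swap_if.
have djS := dyadicS R j; have dj1 := dyadic_le1 R j; have dj0 := dyadic_gt0 R j.+1.
have dh := dyS_half j.-1; have r4 := r_le4.
rewrite /corner_shift /low_side /high_side.
case: j tj djS dj1 dj0 dh => [|j] tj djS dj1 dj0 /= dh tr.
  rewrite expr0 invr1 in djS dj1 *.
  case: tr => tr.
    rewrite ifT; last by apply/andP; split; lra.
    rewrite !ifF ?subrr//; apply/negP => /andP[]; lra.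
  rewrite ifF; last by apply/negP => /andP[]; lra.
  rewrite ifF; last by apply/negP => /andP[]; lra.
  rewrite ifF; last by apply/negP => /andP[]; lra.
  by rewrite ifT ?addr0//; apply/andP; split; lra.
by rewrite !ifF ?addr0//; apply/negP => /andP[]; lra.
Qed.

Lemma cusp_trivialization_trivializes : @trivializes _ _ G c cusp_trivialization.
Proof.
apply: local_trivialization_trivializes corner_shift_glued; last first.
  by move=> b j t; apply: cusp_saturated.
move=> p [b [e [j mp]]]; exists (ball (missing_point R b e j) r); split=> //.
  exact: ball_open.
move=> q mq _; split; first by exists b, e, j.
by rewrite (corner_shift_ball r_le4 mp) (corner_shift_ball r_le4 mq).
Qed.

Lemma cusp_trivializationE (z : S) : cusp_trivialization (pi z) =
  if `[< cusp r (val z) >] then Some (cocycle a (val z) + corner_shift (val z))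
  else None.
Proof.
apply: (local_trivializationE _ corner_shift_glued) => b j t.
exact: cusp_saturated.
Qed.

Lemma cusp_trivialized_set :
  [set x | cusp_trivialization x != None] = pi @` [set z : S | cusp r (val z)].
Proof.
apply/seteqP; split=> [x|_ [z /= cz <-]]; last first.
  by rewrite /= cusp_trivializationE asboolT.
rewrite /= -[x]reprK cusp_trivializationE; case: ifPn => // /asboolP cz _.
by exists (repr x).
Qed.

End CuspTrivialization.

(** The offset 2 makes every radius at most 1/4, as the renumbering near the corners requires. *)
Let t n : X -> option G := cusp_trivialization (dy n.+2).

Let dyS2_le4 n : dy n.+2 <= 4^-1.
Proof. by apply: (le_trans (@dyadic_le R 2 n.+2 isT)); lra. Qed.

Definition chamanara_cover : topologicalType :=
  @twisted_product S {eq_quot @same_point_equiv R}%qT G c.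

Lemma chamanara_cover_ends :
  (ends chamanara_cover #= [set: G])%card.
Proof.
have tE n z := cusp_trivializationE (dyS2_le4 n) z.
apply: (@twisted_ends_card _ _ _ _ t).
- by move=> n; apply: cusp_trivialization_trivializes.
- move=> m n x g mn; rewrite -[x]reprK /t !tE.
  case: ifPn => // /asboolP cz; rewrite asboolT//.
  by apply: cusp_le cz; apply: dyadic_le.
- move=> n; rewrite cusp_trivialized_set; last exact: dyS2_le4.
  apply: cusp_image_connected; first exact: dyadic_gt0.
  exact: dyadic_le1.
- move=> n; rewrite cusp_trivialized_set; last exact: dyS2_le4.
  have djS := dyadicS R n.+2; have dj0 := dyadic_gt0 R n.+3.
  have [z zE] : exists z : S, val z = low_side 0 (dy n.+3).
    apply: in_square; apply/square_with_edgesP; right; exists false, 0%N, (dy n.+3).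
    by split=> //; [rewrite expr1; have := dyS2_le4 n; lra|left].
  exists (pi z), z => //=; rewrite zE; exists false, false, 0%N; apply/ball_pairE.
  by rewrite /missing_point /low_side /= !ltr_norml; split; apply/andP; split; lra.
- move=> n; rewrite (_ : [set z | _] = [set z : S | ~ cusp (dy n.+2) (val z)]).
    exact/cusp_complement_compact/dyadic_gt0.
  apply/seteqP; split=> z /=; rewrite /t tE.
    by case: asboolP.
  by move=> nc; rewrite asboolF.
- move=> x; have [r /andP[r0 r1] nc] := square_avoids_cusp (square_val (repr x)).
  have [n nr] := dyadic_small r0; exists n.
  have {}nr : dy n.+2 < r by apply: le_lt_trans nr; apply: dyadic_le; apply: ltnW.
  (* The bound [s <= 1] keeps [O] saturated under gluing, so that it defines an open set of X. *)
  pose O := [set p : R * R | exists s, [/\ dy n.+2 < s, s <= 1 & ~ cusp s p]].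
  have piO (z : S) : O (val (repr (pi z))) = O (val z).
    apply/propext; split=> -[s [ns s1 ncs]]; exists s; split=> //;
      by move: ncs; rewrite (@cusp_glued_invariant s (repr (pi z)) z) ?reprK.
  have xO : open_nbhs x [set x' : X | O (val (repr x'))].
    split; last by exists r.
    rewrite chamanara_openE (_ : [set z | _] = [set z : S | O (val z)]).
      exact/square_set_open/away_from_cusp_open.
    by apply/seteqP; split=> z /=; rewrite piO.
  apply: filterS (open_nbhs_nbhs xO) => x' [s [ns s1 ncs]].
  rewrite -[x']reprK /t tE asboolF// => cn; apply: ncs.
  by apply: cusp_le cn; apply: ltW.
Qed.

Hypothesis G_cyclic : forall g : G, exists k : nat, g = a *+ k.

Lemma chamanara_cover_finite_abelian :
  finite_abelian_cover (@twisted_proj _ _ G c : chamanara_cover -> X).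
Proof.
(* The midpoint of the first left edge and its partner on the right form the glued pair that joins
   the sheets. *)
have q1 : 0 < (4^-1 : R) by lra.
have q2 : 4^-1 < dy 1 by rewrite expr1; lra.
have [z zE] : exists z : S, val z = low_side 0 4^-1.
  apply: in_square; apply/square_with_edgesP; right; exists false, 0%N, 4^-1.
  by split=> //; left.
have [w wE] : exists w : S, val w = high_side 0 4^-1.
  apply: in_square; apply/square_with_edgesP; right; exists false, 0%N, 4^-1.
  by split=> //; right.
apply: (@twisted_finite_abelian_cover _ _ _ _ _ _ a z w) => //.
- exact: square_connected.
- exact: chamanara_locally_trivial.
- by apply: pi_glued; apply/gluedP; exists false, 0%N, 4^-1; split.
- by rewrite zE wE (cocycle_low a false q1 q2) (cocycle_high a false _ q1) addr0.
Qed.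

End ChamanaraCover.

Theorem theorem4 (R : realType) (d : nat) (hd : (0 < d)%N) :
  exists (Y : topologicalType) (p : Y -> chamanara R),
    finite_abelian_cover p /\ (ends Y #= `I_d)%card.
Proof.
(* [inZp 1] generates the cyclic group also in the one-sheeted case, where it is 0. *)
case: d hd => // d _; pose a : 'I_d.+1 := inZp 1.
exists (@chamanara_cover R 'I_d.+1 a), (@twisted_proj _ _ _ _); split.
  apply: chamanara_cover_finite_abelian => g; exists g.
  by rewrite Zp_mulrn; apply: val_inj; rewrite /= modnMml mul1n modn_small.
by rewrite (card_eqr card_II); apply: chamanara_cover_ends.
Qed.
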